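(* Let $k\ge 3$ be an integer and let $p\ge 1$. Define $$\gamma_p=\begin{cases}\frac14, & \text{if } 1\le p\le 4,\\[2pt] \frac12-\frac1p, & \text{if } p>4.\end{cases}$$ Then there exist a constant $c>0$ and an integer $N_0$ (both depending only on $k$ and $p$) such that for all integers $N\ge N_0$, $$\bigg\|\sup_{0<t<1}\Big|\sum_{n=1}^{N}e^{2\pi i(nx+n^{k}t)}\Big|\bigg\|_{L^{p}(\mathbb{T})}\ge c\,N^{\frac12+\gamma_p}.$$
   Context: $\mathbb{T}=\mathbb{R}/\mathbb{Z}$ is identified with $[0,1)$ with Lebesgue measure, and the $L^p(\mathbb{T})$ norm is taken in the variable $x$. *)

(* Defs.v *)
From mathcomp Require Import all_boot all_order all_algebra.
From mathcomp Require Import all_classical all_reals all_analysis.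
From mathcomp Require Import complex.

Set Implicit Arguments.
Unset Strict Implicit.
Unset Printing Implicit Defensive.

Import Order.TTheory GRing.Theory Num.Theory.
Import numFieldNormedType.Exports.

Local Open Scope classical_set_scope.
Local Open Scope ring_scope.
Local Open Scope complex_scope.

(* e(theta) = exp(2 pi i theta), by Euler's formula: the libraries have no
   exponential on R[i]. *)
Definition e2pi (R : realType) (theta : R) : R[i] :=
  cos (2 * pi * theta) +i* sin (2 * pi * theta).

Definition weyl_sum (R : realType) (k N : nat) (x t : R) : R[i] :=
  \sum_(1 <= n < N.+1) e2pi (n%:R * x + n%:R ^+ k * t).

(* [normc] is the real-valued modulus; the library's norm on R[i] is
   R[i]-valued. *)
Definition weyl_maximal (R : realType) (k N : nat) (x : R) : \bar R :=
  ereal_sup [set (ComplexField.Normc.normc (weyl_sum k N x t))%:E | t in `]0, 1[].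

(* The torus R/Z is represented by its fundamental domain [0, 1). *)
Definition torus_measure (R : realType) :
    {measure set (measurableTypeR R) -> \bar R} :=
  mrestr (@lebesgue_measure R) (measurable_itv `[0, 1[).

Definition gamma_exponent (R : realType) (p : R) : R :=
  if p <= 4 then 4^-1 else 2^-1 - p^-1.

(* Main.v *)
Require Import Defs.
From mathcomp Require Import all_boot all_order all_algebra.
From mathcomp Require Import all_classical all_reals all_analysis.
From mathcomp Require Import measurable_realfun complex ring lra zify.

(** For [p > 4] the bound comes from [|x| << 1/N], where taking [t << N^-k]
    makes all the phases nearly equal to [0].

    For [p <= 4] it is enough that the maximal function be [>> N^(3/4)] on a set
    of measure [>> 1]. Let [S(a,b)] be the sum of [e((a n^k + b n)/q)] over [n]
    mod [q]. Averaging [|S(a,b)|^2] over [a] gives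
    [G_q(b) = sum of e(b(m-n)/q) over m^k = n^k mod q], which is multiplicative
    in [q]. For [q] prime and [b] coprime to [q], [G_q(b) = G_q(1)] because
    dilations preserve the congruence, and averaging over [b] yields
    [G_q(b) >= q - k]. Hence for squarefree [q] with [sum_(p | q) k/p <= 1/2]
    some [a] has [|S(a,b)|^2 >= q/2]. Such [q] have positive density in the
    progression [1] mod [y!], because there only divisors [d > y] matter and
    [sum_(d > y) 1/d^2] is small. Finally, for [q ~ c N^(1/2)], cutting
    the Weyl sum at [t = a/q] into blocks of length [q] gives a modulus
    [>> N/q^(1/2) ~ N^(3/4)] whenever [0 <= x - b/q <= 1/(16N)], and these arcs
    around the reduced fractions [b/q] are disjoint, of total measure [>> 1]. *)

Import Order.TTheory GRing.Theory Num.Theory.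
Import numFieldNormedType.Exports.
Import ComplexField.Normc.

Local Open Scope ring_scope.
Local Open Scope complex_scope.

(** * Lower bounds for the norm *)

(* No measurability of [f] or [g] is needed: the integral of a nonnegative
   function is a supremum over the simple functions below it. *)
Lemma ge0_le_integralT (d : measure_display) (T : measurableType d)
    (R : realType) (mu : {measure set T -> \bar R}) (f g : T -> \bar R) :
  (forall x, 0 <= f x)%E -> (forall x, f x <= g x)%E ->
  (\int[mu]_x f x <= \int[mu]_x g x)%E.
Proof.
move=> f0 fg; rewrite !ge0_integralTE//; last first.
  by move=> x; exact: le_trans (f0 x) (fg x).
apply: ge_ereal_sup => _ [h hf <-]; apply: ereal_sup_ubound.
by exists h => // x; exact: le_trans (hf x) (fg x).
Qed.

(** Chebyshev's inequality: [|f|^p] dominates [a^p] times the indicator of [E]. As [E] lies in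
    [[0, 1)], restricting Lebesgue measure to the torus does not change its measure. *)
Lemma Lnorm_torus_ge (R : realType) (p a m : R) (f : R -> \bar R)
    (E : set R) :
  0 < p -> 0 <= a -> 0 <= m -> measurable E -> (E `<=` `[0, 1[)%classic ->
  (m%:E <= @lebesgue_measure R E)%E -> (forall x, E x -> (a%:E <= f x)%E) ->
  ((a * m `^ p^-1)%:E <= 'N[torus_measure R]_p%:E[f])%E.
Proof.
move=> p0 a0 m0 mE E01 mEm af.
rewrite unlock /Lnorm.
have am : ((a `^ p * m)%:E <= \int[torus_measure R]_x (`|f x| `^ p))%E.
  have -> : ((a `^ p * m)%:E = (a `^ p)%:E * m%:E)%E by rewrite EFinM.
  apply: (@le_trans _ _ ((a `^ p)%:E * torus_measure R E)%E).
    apply: lee_wpmul2l; first by rewrite lee_fin powR_ge0.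
    by rewrite /torus_measure /= /mrestr setIidl.
  rewrite -(setIT E) -integral_indic// -ge0_integralZl_EFin ?powR_ge0//; last first.
    by apply/measurable_EFinP; exact: measurable_indic.
  apply: ge0_le_integralT => x.
  - by rewrite -EFinM lee_fin mulr_ge0// powR_ge0.
  - rewrite indicE; case: (boolP (x \in E)) => xE; last first.
      by rewrite mule0 poweR_ge0.
    rewrite mule1 -poweR_EFin; apply: gt0_ler_poweR => //.
    + exact: ltW.
    + by rewrite in_itv/= leey lee_fin a0.
    + by rewrite in_itv/= leey abse_ge0.
    + by move: xE; rewrite inE => /af/le_trans; apply; exact: lee_abs.
have -> : a * m `^ p^-1 = (a `^ p * m) `^ p^-1.
  by rewrite powRM ?powR_ge0// -powRrM mulfV ?gt_eqF// powRr1.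
rewrite -poweR_EFin; apply: gt0_ler_poweR => //.
- by rewrite invr_ge0 ltW.
- by rewrite in_itv/= leey lee_fin mulr_ge0 ?powR_ge0.
- by rewrite in_itv/= leey integral_ge0// => x _; exact: poweR_ge0.
Qed.

(** * The character e(x) *)

Section Character.
Variable R : realType.
Implicit Types x y : R.

Lemma e2piD x y : e2pi (x + y) = e2pi x * e2pi y.
Proof.
rewrite /e2pi mulrDr cosD sinD; apply/eqP; rewrite eq_complex /=.
by apply/andP; split; apply/eqP; ring.
Qed.

Lemma e2pi0 : e2pi (0 : R) = 1.
Proof. by rewrite /e2pi mulr0 cos0 sin0. Qed.

Lemma e2pi1 : e2pi (1 : R) = 1.
Proof. by rewrite /e2pi mulr1 mulrC mulr_natr cos2pi sin2pi. Qed.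

Lemma e2pi_expn x n : e2pi (n%:R * x) = e2pi x ^+ n.
Proof.
elim: n => [|n IH]; first by rewrite mul0r e2pi0.
by rewrite -addn1 natrD mulrDl mul1r e2piD IH exprD.
Qed.

Lemma e2pi_nat n : e2pi (n%:R : R) = 1.
Proof. by rewrite -[n%:R]mulr1 e2pi_expn e2pi1 expr1n. Qed.

Lemma normc_e2pi x : normc (e2pi x) = 1.
Proof. by rewrite /= cos2Dsin2 sqrtr1. Qed.

Lemma normr_e2pi x : `|e2pi x| = 1.
Proof. by rewrite normc_def /= cos2Dsin2 sqrtr1. Qed.

Lemma normcB1_e2pi x : normc (e2pi x - 1) = 2 * `|sin (pi * x)|.
Proof.
rewrite /= subr0 -[2 * pi * x]mulrA mulr_natl cos_mulr2n sin_mulr2n.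
have -> : (cos (pi * x) ^+ 2 *+ 2 - 1 - 1) ^+ 2 +
    (cos (pi * x) * sin (pi * x) *+ 2) ^+ 2 = (2 * sin (pi * x)) ^+ 2.
  by have := cos2Dsin2 (pi * x); rewrite !exprMn; nra.
by rewrite sqrtr_sqr normrM ger0_norm.
Qed.

Lemma ler_norm_sin x : `|sin x| <= `|x|.
Proof.
wlog x0 : x / 0 <= x.
  move=> H; have [/H//|/ltW x0] := leP 0 x.
  by have := H (- x); rewrite sinN !normrN; apply; rewrite oppr_ge0.
have [->|xn0] := eqVneq x 0; first by rewrite sin0.
have {xn0}x0 : 0 < x by rewrite lt_neqAle eq_sym xn0.
have [|c _] := @MVT R sin cos 0 x x0.
  by apply: continuous_subspaceT => z; exact: continuous_sin.
rewrite sin0 !subr0 => ->; rewrite normrM ler_piMl//; exact: cos_max.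
Qed.

(** The modulus is [2 |sin (pi x)| <= 2 pi |x|], and [pi / 2 < 2] gives [2 pi < 8]. *)
Lemma le_normcB1_e2pi x : normc (e2pi x - 1) <= 8 * `|x|.
Proof.
rewrite normcB1_e2pi; have := ler_norm_sin (pi * x).
rewrite normrM (ger0_norm (pi_ge0 R)) => H.
have := pihalf_lt2 R; have := normr_ge0 x; nra.
Qed.

Lemma e2pi_neq1 x : 0 < x < 1 -> e2pi x != 1.
Proof.
move=> /andP[x0 x1]; apply/eqP => e1.
have := normcB1_e2pi x; rewrite e1 subrr normc0 => /esym/eqP.
rewrite mulf_eq0 pnatr_eq0/= normr_eq0 gt_eqF// sin_gt0_pi//.
by have := pi_gt0 R; nra.
Qed.

Lemma normr_normc (z : R[i]) : `|z| = (normc z)%:C.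
Proof. by rewrite normc_def; case: z. Qed.

Lemma le_normcDl (z w : R[i]) : normc (z + w) <= normc z + normc w.
Proof. exact: le_normcD. Qed.

Lemma normc_sum (I : Type) (r : seq I) (P : pred I) (F : I -> R[i]) :
  normc (\sum_(i <- r | P i) F i) <= \sum_(i <- r | P i) normc (F i).
Proof.
rewrite -lecR -normr_normc rmorph_sum /=.
by under [leRHS]eq_bigr do rewrite -/(real_complex R _) -normr_normc; exact: ler_norm_sum.
Qed.

Lemma le_normcB (z w : R[i]) : normc z - normc w <= normc (z + w).
Proof.
have := le_normcDl (z + w) (- w); rewrite addrK (normcN w).
by rewrite lerBlDr.
Qed.

Lemma normcB_e2pi x y : normc (e2pi x - e2pi y) <= 8 * `|x - y|.
Proof.
have -> : e2pi x - e2pi y = e2pi y * (e2pi (x - y) - 1).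
  by rewrite mulrBr mulr1 -e2piD [y + _]addrC subrK.
by rewrite normcM normc_e2pi mul1r le_normcB1_e2pi.
Qed.

End Character.

(** * Complete exponential sums *)

Section CompleteSums.
Variable R : realType.
Implicit Types (k q a b m n : nat).

Definition zmod_char q m : R[i] := e2pi (m%:R / q%:R).
Local Notation chi := zmod_char.

Definition complete_sum k q a b : R[i] :=
  \sum_(n < q) chi q (a * n ^ k + b * n).

(* [G_q(b)] of the header. *)
Definition power_correlation k q b : R[i] :=
  \sum_(m < q) \sum_(n < q | m ^ k == n ^ k %[mod q])
    chi q (b * m) / chi q (b * n).

Lemma zmod_charD q m n : chi q (m + n) = chi q m * chi q n.
Proof. by rewrite /chi natrD mulrDl e2piD. Qed.

Lemma zmod_char0 q : chi q 0 = 1.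
Proof. by rewrite /chi mul0r e2pi0. Qed.

Lemma zmod_charM q a m : chi q (a * m) = chi q m ^+ a.
Proof. by rewrite /chi natrM -mulrA e2pi_expn. Qed.

Lemma normr_zmod_char q m : `|chi q m| = 1.
Proof. exact: normr_e2pi. Qed.

Lemma zmod_char_neq0 q m : chi q m != 0.
Proof. by rewrite -normr_eq0 normr_zmod_char oner_eq0. Qed.

Lemma conj_zmod_char q m : (chi q m)^*%C = (chi q m)^-1.
Proof. by rewrite invc_norm normr_zmod_char expr1n invr1 mul1r. Qed.

Lemma zmod_char_period q m : (0 < q)%N -> chi q (q * m) = 1.
Proof.
by move=> q0; rewrite /chi natrM mulrAC mulfV ?mul1r ?e2pi_nat ?pnatr_eq0 -?lt0n.
Qed.

Lemma zmod_char_mod q m : (0 < q)%N -> chi q (m %% q) = chi q m.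
Proof.
move=> q0; rewrite [in RHS](divn_eq m q) zmod_charD [(_ %/ _ * _)%N]mulnC.
by rewrite zmod_char_period// mul1r.
Qed.

Lemma eq_mod_zmod_char q m n : (0 < q)%N ->
  m = n %[mod q] -> chi q m = chi q n.
Proof. by move=> q0 mn; rewrite -zmod_char_mod// mn zmod_char_mod. Qed.

Lemma zmod_char_inj q m n : (0 < q)%N ->
  chi q m = chi q n -> m = n %[mod q].
Proof.
move=> q0; rewrite -zmod_char_mod// -(zmod_char_mod q n)//.
have : (m %% q < q)%N by rewrite ltn_mod.
have : (n %% q < q)%N by rewrite ltn_mod.
move: (m %% q)%N (n %% q)%N => {m n}.
move=> m n; wlog mn : m n / (m <= n)%N.
  move=> H; have [/H//|/ltnW nm] := leqP m n.
  by move=> *; apply/esym/H.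
move=> mq nq; rewrite -{1}(subnKC mn) zmod_charD => /esym e.
have {}e : chi q (n - m) = 1.
  by apply: (mulfI (zmod_char_neq0 q m)); rewrite mulr1.
have [|mn0] := leqP n m; first lia.
have : e2pi ((n - m)%:R / q%:R : R) != 1.
  apply: e2pi_neq1; rewrite divr_gt0 ?ltr0n ?subn_gt0//=.
  by rewrite ltr_pdivrMr ?ltr0n// mul1r ltr_nat; lia.
by rewrite -/(chi _ _) e eqxx.
Qed.

(** A geometric sum of ratio [w = chi m / chi n], where [w ^ q = 1], and [w = 1] only if [m = n] mod
    [q]. *)
Lemma zmod_char_orthogonality q m n : (0 < q)%N ->
  \sum_(a < q) chi q (a * m) / chi q (a * n) =
  if m == n %[mod q] then q%:R else 0.
Proof.
move=> q0.
under eq_bigr do rewrite !zmod_charM -expr_div_n.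
case: ifPn => [/eqP mn|mn].
  rewrite (eq_mod_zmod_char _ _ _ q0 mn) divff ?zmod_char_neq0//.
  by under eq_bigr do rewrite expr1n; rewrite sumr_const card_ord.
set w := _ / _; have w1 : w != 1.
  apply: contraNneq mn => w1; apply/eqP/(zmod_char_inj _ _ _ q0).
  by rewrite -[LHS](divfK (zmod_char_neq0 q n)) -/w w1 mul1r.
have /eqP := subrX1 w q.
rewrite /w expr_div_n -!zmod_charM !zmod_char_period// divr1 subrr -/w.
by rewrite eq_sym mulf_eq0 subr_eq0 (negbTE w1) => /eqP.
Qed.

Lemma sum_zmod_char q b : (1 < q)%N -> coprime b q ->
  \sum_(n < q) chi q (b * n) = 0.
Proof.
move=> q1 bq; have := zmod_char_orthogonality q b 0 (ltnW q1).
rewrite mod0n ifF; last first.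
  apply/negbTE; rewrite -[_ == _]/(q %| b)%N; apply/negP => qb.
  by move: bq; rewrite /coprime (gcdn_idPr qb) => /eqP; lia.
by under eq_bigr do rewrite muln0 zmod_char0 divr1 mulnC.
Qed.

(** Once the square is expanded over pairs [(m, n)], orthogonality in [a] keeps exactly the pairs
    with [m ^ k = n ^ k] mod [q]. *)
Lemma sum_sqr_complete_sum k q b : (0 < q)%N ->
  \sum_(a < q) `|complete_sum k q a b| ^+ 2 = q%:R * power_correlation k q b.
Proof.
move=> q0.
transitivity (\sum_(a < q) \sum_(m < q) \sum_(n < q)
    (chi q (b * m) / chi q (b * n)) *
    (chi q (a * m ^ k) / chi q (a * n ^ k))).
  apply: eq_bigr => a _; rewrite sqr_normc rmorph_sum mulr_suml /=.
  apply: eq_bigr => m _; rewrite mulr_sumr; apply: eq_bigr => n _.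
  rewrite [X in _ * X]conj_zmod_char !zmod_charD invfM; ring.
rewrite exchange_big mulr_sumr; apply: eq_bigr => m _ /=.
rewrite exchange_big mulr_sumr [RHS]big_mkcond; apply: eq_bigr => n _ /=.
rewrite -mulr_sumr zmod_char_orthogonality//.
by case: ifP; rewrite ?mulr0// mulrC.
Qed.

(** Orthogonality in [b] leaves the diagonal [m = n], which always satisfies the congruence: [q]
    terms, each equal to [q]. *)
Lemma sum_power_correlation k q : (0 < q)%N ->
  \sum_(b < q) power_correlation k q b = (q ^ 2)%:R.
Proof.
move=> q0; rewrite exchange_big /=.
have E m : (m < q)%N -> \sum_(b < q) \sum_(n < q | m ^ k == n ^ k %[mod q])
    chi q (b * m) / chi q (b * n) = q%:R.
  move=> mq; rewrite exchange_big /= (bigD1 (Ordinal mq)) //=.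
  rewrite zmod_char_orthogonality// eqxx big1 ?addr0// => n /andP[_ nm].
  rewrite zmod_char_orthogonality//; case: ifP => //.
  rewrite !modn_small// => /eqP mn; move: nm.
  by rewrite -val_eqE /= mn eqxx.
rewrite (eq_bigr (fun=> q%:R)); last by move=> m _; exact: E.
by rewrite sumr_const card_ord natrM mulr_natr.
Qed.

Lemma eqn_mod_pmul2r d c m n : coprime d c ->
  (m * c == n * c %[mod d])%N = (m == n %[mod d])%N.
Proof.
move=> dc; wlog nm : m n / (n <= m)%N.
  by move=> H; case: (leqP n m) => [/H//|/ltnW/H]; rewrite eq_sym => ->; rewrite eq_sym.
by rewrite !eqn_mod_dvd ?leq_mul// -mulnBl Gauss_dvdl.
Qed.

(** This form of the Chinese remainder map is chosen so that [h u / (p q) = u.1 / p + u.2 / q] mod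
    [1], which makes characters factor. Injectivity: mod [p] the term [u.2 * p] vanishes and [q] is
    invertible, and symmetrically mod [q]. *)
Lemma crt_bijective p q : coprime p q -> (0 < p)%N -> (0 < q)%N ->
  exists h : 'I_p * 'I_q -> 'I_(p * q),
    bijective h /\
    forall u, nat_of_ord (h u) = ((u.1 * q + u.2 * p) %% (p * q))%N.
Proof.
move=> pq p0 q0; have pq0 : (0 < p * q)%N by rewrite muln_gt0 p0.
exists (fun u : 'I_p * 'I_q => Ordinal (ltn_pmod (u.1 * q + u.2 * p) pq0)); split => //.
apply: inj_card_bij; last by rewrite card_prod !card_ord.
move=> [u v] [u' v'] /(congr1 val) /= /eqP.
rewrite chinese_remainder// => /andP[].
rewrite !modnMDl [X in _ -> is_true X -> _]eqn_mod_pmul2r 1?coprime_sym//.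
rewrite (addnC (u * q)%N) (addnC (u' * q)%N) !modnMDl eqn_mod_pmul2r//.
rewrite !modn_small// => /eqP uu /eqP vv.
by congr pair; exact: val_inj.
Qed.

Lemma eq_mod_expn d k m n : (m = n %[mod d] -> m ^ k = n ^ k %[mod d])%N.
Proof. by move=> mn; rewrite -modnXm mn modnXm. Qed.

(** Modulo [p] the powers are [u ^ k * q ^ k] and [u' ^ k * q ^ k], and [q ^ k] is invertible. *)
Lemma eqn_mod_crt_expn k p q u v u' v' : coprime p q ->
  ((u * q + v * p) ^ k == (u' * q + v' * p) ^ k %[mod p])%N =
  (u ^ k == u' ^ k %[mod p])%N.
Proof.
move=> pq.
have E w w' : ((w * q + w' * p) ^ k = (w * q) ^ k %[mod p])%N.
  by apply: eq_mod_expn; rewrite addnC modnMDl.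
by rewrite !E !expnMn eqn_mod_pmul2r// coprimeXr.
Qed.

(** Under the Chinese remainder map both the character ([chih]) and the congruence condition
    ([condh]) split into a part mod [p] and a part mod [q]. *)
Lemma power_correlationM k p q b : coprime p q -> (0 < p)%N -> (0 < q)%N ->
  power_correlation k (p * q) b =
  power_correlation k p b * power_correlation k q b.
Proof.
move=> pq p0 q0; have pq0 : (0 < p * q)%N by rewrite muln_gt0 p0.
have [h [hbij hE]] := crt_bijective _ _ pq p0 q0.
have chih u : chi (p * q) (b * h u) = chi p (b * u.1) * chi q (b * u.2).
  rewrite hE (eq_mod_zmod_char _ _ (b * (u.1 * q + u.2 * p)))//; last first.
    by rewrite modnMmr.
  rewrite mulnDr zmod_charD /chi !mulnA ![(_ * _ * _)%:R]natrM ![(p * q)%:R]natrM.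
  by congr (e2pi _ * e2pi _); field; rewrite !pnatr_eq0 -!lt0n p0 q0.
have condh u w : (h u ^ k == h w ^ k %[mod p * q])%N =
    (u.1 ^ k == w.1 ^ k %[mod p])%N && (u.2 ^ k == w.2 ^ k %[mod q])%N.
  rewrite !hE !modnXm chinese_remainder// eqn_mod_crt_expn//; congr andb.
  rewrite ![(u.1 * q + _)%N]addnC ![(w.1 * q + _)%N]addnC.
  by rewrite eqn_mod_crt_expn// coprime_sym.
rewrite /power_correlation (reindex h) /=; last exact: onW_bij.
rewrite [RHS]mulr_suml; under [RHS]eq_bigr do rewrite mulr_sumr.
rewrite pair_bigA /=; apply: eq_bigr => u _.
rewrite (reindex h) /=; last exact: onW_bij.
rewrite mulr_suml; under [RHS]eq_bigr do rewrite mulr_sumr.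
rewrite pair_big /=; apply: eq_big => [w|w _]; first by rewrite condh.
by rewrite !chih invfM; ring.
Qed.

End CompleteSums.

(** * Correlations for prime and squarefree moduli *)

Section PrimeModuli.
Variable R : realType.
Implicit Types (k q p b m n : nat).
Local Notation G := (power_correlation R).

(** The solutions are roots of [X^k - m^k] over the field with [p] elements. *)
Lemma card_power_congruence k p m : prime p -> (0 < k)%N ->
  (#|[pred n : 'I_p | m ^ k == n ^ k %[mod p]]| <= k)%N.
Proof.
move=> pr_p k0.
pose f (n : 'I_p) : 'F_p := n%:R.
pose P : {poly 'F_p} := 'X^k - ((m ^ k)%:R)%:P.
have sP : size P = k.+1 by rewrite size_XnsubC.
have f_eq (u v : nat) : (u%:R == v%:R :> 'F_p) = (u == v %[mod p])%N.
  by rewrite -val_eqE /= !val_Fp_nat.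
have finj : injective f.
  by move=> u v /eqP; rewrite f_eq !modn_small// => /eqP/val_inj.
rewrite cardE -(size_map f) -ltnS -sP; apply: max_poly_roots.
- by rewrite -size_poly_eq0 sP.
- apply/allP => x /mapP[n]; rewrite mem_enum inE => /eqP mn ->.
  rewrite rootE /P hornerD hornerN hornerC hornerXn subr_eq0 /f -natrX f_eq.
  by rewrite mn.
- by rewrite map_inj_uniq ?enum_uniq.
Qed.

(** The dilation by [c] permutes the residues, preserves the congruence of [k]-th powers, and turns
    the frequency [1] into [c]. *)
Lemma power_correlation_coprime k q c : (0 < q)%N -> coprime c q ->
  G k q c = G k q 1.
Proof.
move=> q0 cq; have qc : coprime q c by rewrite coprime_sym.
pose h (m : 'I_q) : 'I_q := Ordinal (ltn_pmod (m * c) q0).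
have hinj : injective h.
  move=> m n /(congr1 val) /= /eqP; rewrite eqn_mod_pmul2r// !modn_small//.
  by move=> /eqP/val_inj.
have hbij : bijective h by exact: injF_bij.
have chih (m : 'I_q) : zmod_char R q (1 * h m) = zmod_char R q (c * m).
  by rewrite mul1n /= zmod_char_mod// mulnC.
rewrite /power_correlation [RHS](reindex h) /=; last exact: onW_bij.
apply: eq_bigr => m _; rewrite [RHS](reindex h) /=; last exact: onW_bij.
apply: eq_big => [n|n _]; last by rewrite !chih.
by rewrite !modnXm !expnMn eqn_mod_pmul2r// coprimeXr.
Qed.

(** The value at [0] counts pairs, so it is at most [p k]. The other [p - 1] values coincide, and
    all [p] of them sum to [p ^ 2]; hence [(p - 1) G(1) >= p (p - k) >= (p - 1) (p - k)]. *)
Lemma power_correlation_prime k p b : prime p -> (0 < k)%N -> coprime b p ->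
  (k <= p)%N -> (p - k)%:R <= G k p b.
Proof.
move=> pr_p k0 bp kp; rewrite power_correlation_coprime ?prime_gt0//.
have p1 := prime_gt1 pr_p; have p0 := prime_gt0 pr_p.
have G0 : G k p 0 <= (p * k)%:R.
  rewrite /power_correlation.
  under eq_bigr do under eq_bigr do rewrite mul0n zmod_char0 divr1.
  have -> : (p * k)%:R = \sum_(m < p) k%:R :> R[i].
    by rewrite sumr_const card_ord natrM mulr_natl.
  apply: ler_sum => m _.
  by rewrite sumr_const ler_nat; exact: card_power_congruence.
have := sum_power_correlation R k p p0; rewrite (bigD1 (Ordinal p0)) //=.
rewrite (eq_bigr (fun=> G k p 1)); last first.
  move=> c c0; apply: power_correlation_coprime => //.
  rewrite coprime_sym prime_coprime// gtnNdvd//.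
  by rewrite lt0n -val_eqE in c0 *.
rewrite sumr_const cardC1 card_ord => H.
have p10 : (0 : R[i]) < (p.-1)%:R by rewrite ltr0n; lia.
rewrite -(ler_pM2r p10) [G k p 1 * _]mulr_natr.
rewrite -(lerD2l (G k p 0)) H -lerBrDr; apply: le_trans G0 _.
rewrite -natrM -natrB ?ler_nat; last by nia.
by rewrite -mulnn; nia.
Qed.

Lemma power_correlation_squarefree k b (s : seq nat) : (0 < k)%N ->
  all prime s -> uniq s -> all (leq k) s -> coprime b (\prod_(p <- s) p) ->
  (\prod_(p <- s) (p - k))%:R <= G k (\prod_(p <- s) p) b.
Proof.
move=> k0; elim: s => [|p s IH] /=.
  rewrite !big_nil /power_correlation => _ _ _ _.
  rewrite big_ord1 big_mkcond big_ord1 /= !modn1 eqxx muln0 zmod_char0.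
  by rewrite divr1.
case/andP=> pr_p pr_s /andP[ps us] /andP[kp ks].
rewrite !big_cons coprimeMr => /andP[bp bs].
have s0 : (0 < \prod_(p0 <- s) p0)%N.
  rewrite big_seq; apply: (big_ind (leq 1)) => //; first by move=> x y; rewrite muln_gt0 => ->.
  by move=> r rs; rewrite prime_gt0// (allP pr_s).
have cps : coprime p (\prod_(p0 <- s) p0).
  rewrite big_seq; apply: (big_ind (coprime p)); first exact: coprimen1.
    by move=> x y cx cy; rewrite coprimeMr cx.
  move=> r rs; rewrite prime_coprime// dvdn_prime2// ?(allP pr_s)//.
  by apply: contraNneq ps => ->.
rewrite power_correlationM ?(prime_gt0 pr_p)// natrM ler_pM ?ler0n//.
  exact: power_correlation_prime.
exact: IH.
Qed.

End PrimeModuli.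

(** * Divisors in an arithmetic progression *)

(** If [e] divides some [M j + 1], then [e] is coprime to [M], so the solutions [j] form one residue
    class mod [e], which meets a window of length at most [e] at most once. *)
Lemma count_progression_short (M e A L : nat) : (L <= e)%N ->
  (\sum_(A <= j < A + L) (e %| M * j + 1) <= 1)%N.
Proof.
move=> Le; have [/hasP[j jA ej]|/hasPn no] :=
    boolP (has (fun j => e %| M * j + 1)%N (index_iota A (A + L))); last first.
  by rewrite big_seq big1// => j /no /negbTE ->.
rewrite (bigD1_seq j) ?iota_uniq//= ej big1_seq ?addn0// => i /andP[ij iA].
apply/eqP; rewrite eqb0; apply/negP => ei; case/eqP: ij.
have eM : coprime e M.
  by apply: (coprime_dvdl ej); rewrite coprime_sym /coprime mulnC gcdnMDl gcdn1.
have : (i == j %[mod e])%N.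
  rewrite -(eqn_mod_pmul2r _ _ _ _ eM) -(eqn_modDr 1) ![(_ * M)%N]mulnC.
  by rewrite /dvdn in ei ej; rewrite (eqP ei) (eqP ej).
move: jA iA; rewrite !mem_index_iota.
wlog ij : i j {ei ej} / (i <= j)%N.
  move=> H; have [|/ltnW ji] := leqP i j; first exact: H.
  by move=> ? ?; rewrite eq_sym => ?; apply/esym/H.
move=> /andP[Aj jL] /andP[Ai iL]; rewrite eq_sym eqn_mod_dvd// => eij.
have [|ji] := leqP j i; first lia.
by rewrite -subn_gt0 in ji; have := dvdn_leq ji eij; lia.
Qed.

Lemma count_progression_le (M e A L : nat) : (0 < e)%N ->
  (\sum_(A <= j < A + L) (e %| M * j + 1) <= L %/ e + 1)%N.
Proof.
move=> e0; elim/ltn_ind: L A => L IH A; have [Le|eL] := leqP L e.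
  exact: leq_trans (count_progression_short _ _ _ _ Le) (leq_addl _ _).
rewrite (@big_cat_nat _ _ _ (A + e)) ?leq_addr ?leq_add2l ?(ltnW eL)//=.
have L1 : (L - e < L)%N by lia.
have := IH _ L1 (A + e)%N; rewrite -addnA subnKC ?(ltnW eL)// => H2.
have := count_progression_short M e A e (leqnn e) => H1.
have -> : (L %/ e = 1 + (L - e) %/ e)%N.
  by rewrite -{1}(subnKC (ltnW eL)) divnDl// divnn e0.
lia.
Qed.

(** * Average of the divisor weight along the progression *)

Section Sums.
Variable R : realType.

Lemma sum_inv_sqr_le (y X : nat) : (0 < y)%N ->
  \sum_(y.+1 <= d < X.+1) (d%:R ^- 2) <= y%:R^-1 :> R.
Proof.
move=> y0; have [Xy|yX] := leqP X y.
  by rewrite big_geq ?invr_ge0 ?ler0n// ltnS.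
(* The stronger bound telescopes: [1 / (z + 1) ^ 2 <= 1 / (z (z + 1)) = 1 / z - 1 / (z + 1)]. *)
suff : \sum_(y.+1 <= d < X.+1) (d%:R ^- 2) <= y%:R^-1 - X%:R^-1 :> R.
  by move/le_trans; apply; rewrite gerBl invr_ge0.
elim: X yX => // X IH yX; rewrite big_nat_recr//=.
have X1 : 0 < X.+1%:R :> R by rewrite ltr0n.
have [Xy|{}/IH IH] := leqP X y.
  have -> : X = y by lia.
  rewrite big_geq// add0r -addn1 natrD; have : 0 < y%:R :> R by rewrite ltr0n.
  move: (y%:R : R) => z z0.
  have -> : z^-1 - (z + 1)^-1 = (z * (z + 1))^-1 by field; rewrite !gt_eqF//; lra.
  by rewrite lef_pV2 ?posrE; nra.
have X0 : 0 < X%:R :> R by rewrite ltr0n; lia.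
apply: (le_trans (lerD IH (lexx _))).
suff : X.+1%:R ^- 2 <= X%:R^-1 - X.+1%:R^-1 :> R.
  by move: (X.+1%:R ^- 2) (X%:R^-1) (X.+1%:R^-1) (y%:R^-1) => ? ? ? ?; lra.
rewrite -addn1 natrD; move: (X%:R : R) X0 => z z0.
have -> : z^-1 - (z + 1)^-1 = (z * (z + 1))^-1 by field; rewrite !gt_eqF//; lra.
by rewrite lef_pV2 ?posrE; nra.
Qed.

Lemma sum_leq_bool (X D : nat) : (\sum_(1 <= d < X.+1) (d <= D) = minn X D)%N.
Proof.
elim: X => [|X IH]; first by rewrite big_geq// min0n.
by rewrite big_nat_recr//= IH; case: leqP; lia.
Qed.

(** A substitute for the logarithmic bound: terms with [d <= D] are at most [1], the others at most
    [1 / D]. For fixed large [D] the bound is a small multiple of [X] plus a constant. *)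
Lemma sum_inv_le (X D : nat) : (0 < D)%N ->
  \sum_(1 <= d < X.+1) (d%:R^-1) <= D%:R + X%:R / D%:R :> R.
Proof.
move=> D0; have D0' : 0 < D%:R :> R by rewrite ltr0n.
apply: (@le_trans _ _ (\sum_(1 <= d < X.+1) ((d <= D)%:R + D%:R^-1))).
  rewrite big_nat [leRHS]big_nat; apply: ler_sum => d /andP[d0 _].
  have d0' : 0 < d%:R :> R by rewrite ltr0n.
  have [dD|Dd] := leqP d D.
    rewrite (@le_trans _ _ 1)//; first by rewrite invf_le1// ler1n.
    by rewrite lerDl invr_ge0 ler0n.
  by rewrite add0r lef_pV2 ?posrE// ler_nat ltnW.
rewrite big_split/= sumr_const_nat subSS subn0 mulr_natl lerD2r -natr_sum.
by rewrite ler_nat sum_leq_bool geq_minr.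
Qed.

(** A substitute for [sqrt X], shaped like [sum_inv_le]: if [d ^ 2 <= X] then [d <= D] or
    [d <= X / D]. *)
Lemma sum_sqr_leq_bool (y X D : nat) : (0 < D)%N ->
  (\sum_(y.+1 <= d < X.+1) (d ^ 2 <= X) <= D + X %/ D)%N.
Proof.
move=> D0; have [Xy|yX] := leqP X y; first by rewrite big_geq.
apply: (@leq_trans (\sum_(y.+1 <= d < X.+1) (d <= D + X %/ D))).
  apply: leq_sum => d _; case: (leqP (d ^ 2) X) => // dX.
  rewrite lt0b; have [dD|Dd] := leqP d D; first by rewrite (leq_trans dD) ?leq_addr.
  rewrite (@leq_trans (X %/ D))%N ?leq_addl// leq_divRL//.
  by rewrite (leq_trans _ dX)// -mulnn leq_mul2l (ltnW Dd) orbT.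
apply: (@leq_trans (\sum_(1 <= d < X.+1) (d <= D + X %/ D))).
  by rewrite [leqRHS](@big_cat_nat _ _ _ y.+1)//= ?leq_addl// ltnW.
by rewrite sum_leq_bool geq_minr.
Qed.

(* A weight at most [1/2] excludes square divisors [d ^ 2] with [y < d], and
   bounds the sum of [k / p] over the prime divisors [p > y]. *)
Definition bad_weight (k y X q : nat) : R :=
  \sum_(y.+1 <= d < X.+1) ((d %| q)%:R * (k%:R / d%:R) + (d ^ 2 %| q)%:R).

Lemma bad_weight_ge0 k y X q : 0 <= bad_weight k y X q.
Proof.
by apply: sumr_ge0 => d _; rewrite addr_ge0 ?ler0n// !mulr_ge0 ?invr_ge0 ?ler0n.
Qed.

Lemma sum_count_progression_le (M e A L : nat) : (0 < e)%N ->
  \sum_(A <= j < A + L) (e %| M * j + 1)%:R <= L%:R / e%:R + 1 :> R.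
Proof.
move=> e0; rewrite -natr_sum.
apply: (@le_trans _ _ (L %/ e + 1)%:R).
  by rewrite ler_nat count_progression_le.
rewrite natrD lerD2r ler_pdivlMr ?ltr0n// -natrM ler_nat; exact: leq_divM.
Qed.

(** After exchanging the sums, a divisor [e] is met at most [J / e + 1] times. The terms [J / e]
    produce sums of [1 / d ^ 2], of size [1 / y]; the terms [1] produce the sum of [k / d] and the
    number of [d] with [d ^ 2 <= X]. *)
Lemma sum_bad_weight_le (k M J y D : nat) (X := (2 * M * J)%N) :
  (0 < y)%N -> (0 < D)%N -> (0 < M)%N ->
  \sum_(J <= j < J + J) bad_weight k y X (M * j + 1) <=
  k.+1%:R * (J%:R / y%:R + (D%:R + X%:R / D%:R)).
Proof.
move=> y0 D0 M0; rewrite exchange_big /=.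
apply: (@le_trans _ _ (\sum_(y.+1 <= d < X.+1)
    (k%:R * (J%:R * d%:R ^- 2) + k%:R * d%:R^-1 + J%:R * d%:R ^- 2
     + (d ^ 2 <= X)%:R))).
  rewrite big_nat [leRHS]big_nat; apply: ler_sum => d /andP[yd dX].
  have d0 : (0 < d)%N by lia.
  have d0' : 0 < d%:R :> R by rewrite ltr0n.
  rewrite big_split /= -mulr_suml -[leRHS]addrA lerD//.
    have /(ler_wpM2r _) H := sum_count_progression_le M d J J d0.
    apply: le_trans (H (k%:R / d%:R) _) _; first by rewrite mulr_ge0 ?invr_ge0 ?ler0n.
    by rewrite le_eqVlt; apply/orP; left; apply/eqP; field; rewrite gt_eqF.
  have [d2X|Xd2] := leqP (d ^ 2) X.
    have := sum_count_progression_le M (d ^ 2) J J.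
    by rewrite expn_gt0 d0 natrX; exact.
  (* If [d ^ 2 > X], no term vanishes mod [d ^ 2], because [0 < M j + 1 <= X] for [j < 2 J]. *)
  rewrite big_nat big1 ?addr0 ?mulr_ge0 ?invr_ge0 ?exprn_ge0 ?ler0n//.
  move=> j /andP[_ j2]; case: (boolP (_ %| _)%N) => // /dvdn_leq H.
  have := H (ltac:(lia)); rewrite /X in Xd2; nia.
rewrite !big_split /= -!mulr_sumr.
have H1 := sum_inv_sqr_le y X y0.
have H2 : \sum_(y.+1 <= d < X.+1) (d%:R^-1) <= D%:R + X%:R / D%:R :> R.
  apply: le_trans (sum_inv_le X D D0).
  have [Xy|yX] := leqP X y.
    by rewrite big_geq// sumr_ge0// => d _; rewrite invr_ge0 ler0n.
  rewrite [leRHS](@big_cat_nat _ _ _ y.+1)//= ?lerDr; last by rewrite ltnW.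
  by rewrite sumr_ge0// => d _; rewrite invr_ge0 ler0n.
have H3 : \sum_(y.+1 <= d < X.+1) ((d ^ 2 <= X)%N%:R) <= D%:R + X%:R / D%:R :> R.
  rewrite -natr_sum; apply: (@le_trans _ _ (D + X %/ D)%:R).
    by rewrite ler_nat sum_sqr_leq_bool.
  rewrite natrD lerD2l ler_pdivlMr ?ltr0n// -natrM ler_nat; exact: leq_divM.
move: H1 H2 H3; set S1 := \sum_(_ <= _ < _) _; set S2 := \sum_(_ <= _ < _) _.
set S3 := \sum_(_ <= _ < _) _; rewrite -addn1 natrD.
have := ler0n R J; have := ler0n R k; set Y := y%:R^-1; set Z := D%:R + X%:R / D%:R.
move: (k%:R : R) (J%:R : R) S1 S2 S3 Y Z => a b S1 S2 S3 Y Z.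
move=> a0 b0 /(ler_wpM2l b0) H1 H2 H3.
by have := ler_wpM2l a0 H1; have := ler_wpM2l a0 H2; lra.
Qed.

End Sums.

(** * Squarefree moduli with large complete sums *)

Lemma prod_primes_squarefree (q : nat) : (0 < q)%N ->
  (forall p, prime p -> ~~ (p ^ 2 %| q)%N) -> (\prod_(p <- primes q) p)%N = q.
Proof.
move=> q0 sq; rewrite [RHS](prod_prime_decomp q0) prime_decompE big_map /=.
rewrite [LHS]big_seq [RHS]big_seq; apply: eq_bigr => p.
rewrite mem_primes => /and3P[pr_p _ pq].
suff -> : logn p q = 1%N by rewrite expn1.
have := sq p pr_p; rewrite pfactor_dvdn// -ltnNge ltnS => l1.
by apply/eqP; rewrite eqn_leq l1 -pfactor_dvdn// expn1.
Qed.

Lemma totient_squarefree (q : nat) : (0 < q)%N ->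
  (forall p, prime p -> ~~ (p ^ 2 %| q)%N) ->
  totient q = (\prod_(p <- primes q) p.-1)%N.
Proof.
move=> q0 sq; rewrite totientE// [LHS]big_seq [RHS]big_seq.
apply: eq_bigr => p; rewrite mem_primes => /and3P[pr_p _ pq].
have := sq p pr_p; rewrite pfactor_dvdn// -ltnNge ltnS => l1.
by have -> : (logn p q).-1 = 0%N by [lia|]; rewrite expn0 muln1.
Qed.

(** The Weierstrass product inequality; the induction also carries that the product lies in
    [[0, 1]]. *)
Lemma ler_prod_1B (R : realFieldType) (I : Type) (s : seq I) (x : I -> R) :
  (forall i, 0 <= x i <= 1) ->
  1 - \sum_(i <- s) x i <= \prod_(i <- s) (1 - x i).
Proof.
move=> x01.
suff : 1 - \sum_(i <- s) x i <= \prod_(i <- s) (1 - x i) <= 1 /\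
    0 <= \prod_(i <- s) (1 - x i) by case=> /andP[].
elim: s => [|i s []]; first by rewrite !big_nil subr0 lexx.
rewrite !big_cons; have := x01 i.
have : 0 <= \sum_(j <- s) x j by apply: sumr_ge0 => j _; case/andP: (x01 j).
move: (x i) (\sum_(j <- s) x j) (\prod_(j <- s) (1 - x j)) => a S P.
by split; [apply/andP; split|]; nra.
Qed.

Section GoodModuli.
Variable R : realType.

Lemma prodB_primes_ge (k q : nat) : (0 < q)%N ->
  (forall p, prime p -> ~~ (p ^ 2 %| q)%N) ->
  (forall p, prime p -> (p %| q)%N -> (k <= p)%N) ->
  \sum_(p <- primes q) (k%:R / p%:R) <= 2^-1 :> R ->
  (q <= 2 * \prod_(p <- primes q) (p - k))%N.
Proof.
move=> q0 sq kp ksum; rewrite -(ler_nat R) natrM.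
rewrite big_seq natr_prod.
(* [ler_prod_1B] wants values in [[0, 1]] at every index; truncating at [1] ensures this and changes
   nothing at the primes dividing [q], where [k <= p]. *)
have E p : p \in primes q -> (p - k)%:R = p%:R * (1 - Num.min 1 (k%:R / p%:R)) :> R.
  rewrite mem_primes => /and3P[pr_p _ pq].
  have p0 : 0 < p%:R :> R by rewrite ltr0n prime_gt0.
  rewrite natrB ?kp// min_r; last by rewrite ler_pdivrMr// mul1r ler_nat kp.
  by rewrite mulrBr mulr1 mulrC divfK ?gt_eqF.
rewrite (eq_bigr _ E) -big_seq big_split /= -natr_prod prod_primes_squarefree//.
have := @ler_prod_1B R _ (primes q) (fun p => Num.min 1 (k%:R / p%:R)).
have H p : 0 <= Num.min 1 (k%:R / p%:R : R) <= 1.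
  by rewrite ge_min lexx le_min ler01 divr_ge0 ?ler0n.
move=> /(_ H); have : \sum_(p <- primes q) Num.min 1 (k%:R / p%:R) <= 2^-1 :> R.
  by apply: le_trans ksum; apply: ler_sum => p _; rewrite ge_min lexx orbT.
have : 0 < q%:R :> R by rewrite ltr0n.
move: (q%:R : R) (\sum_(p <- primes q) Num.min 1 (k%:R / p%:R)) => z S z0.
move: (\prod_(p <- primes q) _) => P; nra.
Qed.

Lemma exists_complete_sum_ge (k q b : nat) : (0 < k)%N -> (1 < q)%N ->
  (forall p, prime p -> ~~ (p ^ 2 %| q)%N) ->
  (forall p, prime p -> (p %| q)%N -> (k <= p)%N) ->
  \sum_(p <- primes q) (k%:R / p%:R) <= 2^-1 :> R -> coprime b q ->
  exists2 a, (0 < a < q)%N &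
    q%:R <= 2 * normc (complete_sum R k q a b) ^+ 2.
Proof.
move=> k0 q1 sq kp ksum bq; have q0 := ltnW q1.
have lb := prodB_primes_ge k q q0 sq kp ksum.
have G : (q%:R : R[i]) <= 2 * power_correlation R k q b.
  have := power_correlation_squarefree R k b (primes q) k0.
  rewrite prod_primes_squarefree// primes_uniq => H.
  have {}H : (\prod_(p <- primes q) (p - k))%:R <= power_correlation R k q b.
    apply: H => //; apply/allP => p; rewrite mem_primes => /and3P[pr_p _ pq] //.
    exact: kp.
  by rewrite (le_trans _ (ler_wpM2l _ H))// -natrM ler_nat.
have sumS := sum_sqr_complete_sum R k q b q0.
pose f (a : 'I_q) : R := normc (complete_sum R k q a b) ^+ 2.
have sumf : q%:R * q%:R <= 2 * \sum_(a < q) f a.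
  rewrite -lecR !rmorphM rmorph_sum /= !rmorph_nat.
  rewrite (eq_bigr (fun a : 'I_q => `|complete_sum R k q a b| ^+ 2)); last first.
    by move=> a _; rewrite normr_normc -rmorphXn.
  by rewrite sumS mulrCA ler_wpM2l ?ler0n.
(* Some [a] reaches the average, which is at least [q / 2]. *)
have [a fa] : exists a : 'I_q, q%:R <= 2 * f a.
  apply/existsP; apply: contraTT sumf => /existsPn H.
  rewrite -ltNge mulr_sumr.
  have -> : q%:R * q%:R = \sum_(a < q) q%:R :> R.
    by rewrite sumr_const card_ord mulr_natr.
  apply: ltr_sum => [|a _]; last by rewrite ltNge.
  by apply/hasP; exists (Ordinal q0); rewrite // mem_index_enum.
(* For [a = 0] the complete sum vanishes, as [b] is coprime to [q]; so [a / q] lies in the open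
   interval [(0, 1)]. *)
exists a => //; rewrite ltn_ord andbT lt0n; apply/eqP => a0.
move: fa; rewrite /f /complete_sum a0.
under eq_bigr do rewrite mul0n add0n.
by rewrite sum_zmod_char// normc0 expr0n /= mulr0 leNgt ltr0n q0.
Qed.

Lemma prime_gt_fact_succ (y j p : nat) : prime p ->
  (p %| y`! * j + 1)%N -> (y < p)%N.
Proof.
move=> pr_p pq; rewrite ltnNge; apply/negP => py.
have : (p %| y`! * j)%N by rewrite dvdn_mulr// dvdn_fact// prime_gt0.
move=> /dvdn_addr E; move: pq pr_p; rewrite E dvdn1 => /eqP ->.
by [].
Qed.

(** A single square divisor [p ^ 2] already contributes [1 > 1/2] to the weight. *)
Lemma squarefree_of_bad_weight (k y X q p : nat) : (0 < q <= X)%N -> prime p ->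
  (y < p)%N -> bad_weight R k y X q <= 2^-1 -> ~~ (p ^ 2 %| q)%N.
Proof.
move=> /andP[q0 qX] pr_p yp; apply: contraTN => p2q.
have pX : (p < X.+1)%N.
  rewrite ltnS (leq_trans _ qX)// dvdn_leq//.
  by apply: dvdn_trans p2q; rewrite dvdn_exp.
rewrite /bad_weight (bigD1_seq p) ?mem_index_iota ?iota_uniq ?yp//= p2q.
rewrite -ltNge ltr_wpDr//.
  by apply: sumr_ge0 => d _; rewrite addr_ge0 ?ler0n// !mulr_ge0 ?invr_ge0 ?ler0n.
by rewrite ltr_wpDl ?mulr_ge0 ?invr_ge0 ?ler0n//= invf_lt1 ?ltr1n.
Qed.

Lemma sum_primes_le_bad_weight (k y X q : nat) : (0 < q <= X)%N ->
  (forall p, prime p -> (p %| q)%N -> (y < p)%N) ->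
  \sum_(p <- primes q) (k%:R / p%:R) <= bad_weight R k y X q.
Proof.
move=> /andP[q0 qX] yp.
have pq : perm_eq (primes q)
    [seq d <- index_iota y.+1 X.+1 | prime d && (d %| q)%N].
  apply: uniq_perm; rewrite ?primes_uniq ?filter_uniq ?iota_uniq// => p.
  rewrite mem_primes mem_filter mem_index_iota q0 /= -andbA.
  apply/andP/and3P => [[pr_p pq]|[pr_p pq _]]; split=> //.
  by rewrite yp//= ltnS (leq_trans _ qX)// dvdn_leq.
rewrite (perm_big _ pq) big_filter big_mkcond; apply: ler_sum => d _.
case: ifP => [/andP[_ ->]|_]; first by rewrite mul1r lerDl ler0n.
by rewrite addr_ge0 ?ler0n// !mulr_ge0 ?invr_ge0 ?ler0n.
Qed.

(** The moduli are the [M j + 1] with [J <= j < 2 J] and weight at most [1/2]; by Markov's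
    inequality at least half of these [j] qualify. The totient bound later counts the arcs. *)
Lemma good_moduli (k : nat) : (0 < k)%N ->
  exists M J0 : nat, (0 < M)%N /\ forall J, (J0 <= J)%N ->
  exists s : seq nat, [/\ uniq s, (J <= 2 * size s)%N &
    forall q, q \in s -> [/\ (M * J < q)%N, (q <= 2 * M * J)%N,
      (q <= 2 * totient q)%N &
      forall b, coprime b q -> exists2 a, (0 < a < q)%N &
        q%:R <= 2 * normc (complete_sum R k q a b) ^+ 2]].
Proof.
(* In the bound of [sum_bad_weight_le], [y] makes the first term [J / 16], [D] makes the one with
   [X / D] another [J / 16], and the threshold on [J] makes [(k + 1) D <= J / 8]. The total is at
   most [J / 4], so at most [J / 2] indices have weight above [1/2]. *)
move=> k0; pose y := (16 * k.+1)%N; pose M := y`!.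
pose D := (32 * k.+1 * M)%N; exists M, (8 * k.+1 * D + 1)%N.
have M0 : (0 < M)%N by exact: fact_gt0.
have y0 : (0 < y)%N by rewrite /y muln_gt0.
have D0 : (0 < D)%N by rewrite /D muln_gt0 M0.
split => // J J0J.
pose X := (2 * M * J)%N.
pose good j := bad_weight R k y X (M * j + 1) <= 2^-1.
exists [seq (M * j + 1)%N | j <- [seq j <- index_iota J (J + J) | good j]]; split.
- rewrite map_inj_uniq ?filter_uniq ?iota_uniq// => i j /eqP.
  by rewrite eqn_add2r eqn_mul2l => /orP[|/eqP//]; lia.
- rewrite size_map size_filter.
  have := @sum_bad_weight_le R k M J y D y0 D0 M0; rewrite -/X => W.
  have cc := count_predC good (index_iota J (J + J)).
  rewrite size_iota addnK in cc.
  suff : (2 * count (predC good) (index_iota J (J + J)) <= J)%N.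
    move: (count good _) (count (predC good) _) cc => a b; clear; lia.
  rewrite -(ler_nat R) natrM.
  have : (count (predC good) (index_iota J (J + J)))%:R * 2^-1 <= J%:R / 4 :> R.
    apply: le_trans (_ : _ <= k.+1%:R * (J%:R / y%:R + (D%:R + X%:R / D%:R))) _.
      apply: le_trans W; rewrite -sum1_count natr_sum mulr_suml big_mkcond /=.
      apply: ler_sum => j _; case: ifPn => [|_]; last exact: bad_weight_ge0.
      by rewrite /good -ltNge mul1r => /ltW.
    have k1 : 0 < k.+1%:R :> R by rewrite ltr0n.
    have M0' : 0 < M%:R :> R by rewrite ltr0n.
    have : 8 * k.+1%:R * D%:R <= J%:R :> R.
      by rewrite -!natrM ler_nat (leq_trans _ J0J) ?leq_addr.
    have -> : X%:R / D%:R = J%:R / (16 * k.+1%:R) :> R.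
      have -> : X%:R = 2 * M%:R * J%:R :> R by rewrite /X 2!natrM.
      have -> : D%:R = 32 * k.+1%:R * M%:R :> R by rewrite /D 2!natrM.
      move: (M%:R : R) M0' (J%:R : R) => m m0 l; field.
      by rewrite !gt_eqF.
    rewrite /y natrM; move: (D%:R : R) => d.
    have -> : k.+1%:R * (J%:R / (16 * k.+1%:R) + (d + J%:R / (16 * k.+1%:R)))
        = J%:R / 8 + k.+1%:R * d :> R.
      by field; rewrite gt_eqF.
    lra.
  lra.
- move=> x /mapP[j]; rewrite mem_filter mem_index_iota => /and3P[gj Jj jJ] ->.
  set q := (M * j + 1)%N.
  have qX : (0 < q <= X)%N.
    by rewrite /q addn1 /= /X -mulnA [(M * J)%N]mulnC mulnA [(M * j)%N]mulnC; nia.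
  have q1 : (1 < q)%N by rewrite /q addn1 ltnS muln_gt0 M0; lia.
  have yp p : prime p -> (p %| q)%N -> (y < p)%N by exact: prime_gt_fact_succ.
  have sq p : prime p -> ~~ (p ^ 2 %| q)%N.
    move=> pr_p; apply/negP => p2q.
    have yp' : (y < p)%N.
      by apply: yp => //; apply: dvdn_trans p2q; rewrite dvdn_exp.
    by have := squarefree_of_bad_weight k y X q p qX pr_p yp' gj; rewrite p2q.
  have kp p : prime p -> (p %| q)%N -> (k <= p)%N.
    by move=> pr_p /(yp _ pr_p); rewrite /y; lia.
  have ks : \sum_(p <- primes q) (k%:R / p%:R) <= 2^-1 :> R.
    exact: le_trans (sum_primes_le_bad_weight k y X q qX yp) gj.
  split; [by rewrite /q; nia|by case/andP: qX| |].
  (* The totient is the product of the [p - 1], which dominates that of the [p - k]. *)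
  - rewrite totient_squarefree; [|lia|exact: sq].
    apply: leq_trans (prodB_primes_ge k q _ sq kp ks) _; first lia.
    by rewrite leq_mul2l /=; apply: leq_prod => p _; lia.
  - by move=> b; exact: exists_complete_sum_ge.
Qed.
End GoodModuli.

(** * The Weyl sum on a major arc *)

Section MajorArc.
Variable R : realType.

(** Each term is within [8 / 16 = 1/2] of [1]. *)
Lemma sum_e2pi_ge (m n : nat) (u : nat -> R) : (m <= n)%N ->
  (forall i, (m <= i < n)%N -> 0 <= u i <= 16^-1) ->
  (n - m)%:R / 2 <= normc (\sum_(m <= i < n) e2pi (u i)).
Proof.
move=> mn u16.
have -> : \sum_(m <= i < n) e2pi (u i) =
    (n - m)%:R + \sum_(m <= i < n) (e2pi (u i) - 1).
  by rewrite sumrB sumr_const_nat addrC subrK.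
apply: le_trans (le_normcB _ _ _).
have -> : normc ((n - m)%:R : R[i]) = (n - m)%:R.
  apply/eqP; rewrite -(inj_eq (@complexI R)) -normr_normc rmorph_nat.
  by rewrite ger0_norm// ler0n.
suff : normc (\sum_(m <= i < n) (e2pi (u i) - 1)) <= (n - m)%:R / 2.
  by move: (n - m)%:R => ? ?; lra.
apply: le_trans (normc_sum _ _ _ _ _) _.
have -> : (n - m)%:R / 2 = \sum_(m <= i < n) 2^-1 :> R.
  by rewrite sumr_const_nat mulr_natl.
rewrite big_nat [leRHS]big_nat; apply: ler_sum => i /u16 /andP[u0 u1].
by apply: le_trans (le_normcB1_e2pi _ _) _; rewrite ger0_norm//; lra.
Qed.

(** On each block of length [q] the arithmetic factor is periodic, and [e(n x)] is replaced by its
    value at the start of the block. This costs at most [8 q x] per term, hence [8 q ^ 2 x] per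
    block. *)
Lemma blocks_approx (k q a b L : nat) (x : R) : (0 < q)%N -> 0 <= x ->
  normc (\sum_(0 <= n < L * q)
      zmod_char R q (a * n ^ k + b * n) * e2pi (n%:R * x) -
    complete_sum R k q a b * \sum_(l < L) e2pi (l%:R * (q%:R * x))) <=
  L%:R * (8 * q%:R ^+ 2 * x).
Proof.
move=> q0 x0; elim: L => [|L IH].
  by rewrite mul0n big_geq// big_ord0 mulr0 subr0 normc0 mul0r.
rewrite (@big_cat_nat _ _ _ (L * q)) ?leq_mul//=.
rewrite big_ord_recr /= mulrDr.
set A := \sum_(0 <= _ < _) _ in IH *.
set B := complete_sum R k q a b * \sum_(l < L) _ in IH *.
set C := \sum_(_ <= _ < _) _; set E := _ * e2pi _.
have -> : A + C - (B + E) = (A - B) + (C - E) by ring.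
apply: le_trans (le_normcDl _ _ _) _.
rewrite -addn1 natrD mulrDl mul1r; apply: lerD => //.
have -> : C - E = \sum_(r < q) zmod_char R q (a * r ^ k + b * r) *
    (e2pi ((L * q + r)%N%:R * x) - e2pi (L%:R * (q%:R * x))).
  rewrite /E /complete_sum mulr_suml.
  have -> : C = \sum_(r < q) zmod_char R q (a * r ^ k + b * r) *
      e2pi ((L * q + r)%N%:R * x).
    rewrite /C -{1}[(L * q)%N]add0n big_addn.
    have -> : (L.+1 * q - L * q = q)%N by rewrite mulSn addnK.
    rewrite big_mkord; apply: eq_bigr => r _; rewrite (addnC r); congr (_ * _).
    rewrite zmod_charD [RHS]zmod_charD !zmod_charM.
    rewrite (eq_mod_zmod_char R q (L * q + r) r)// ?modnMDl//.
    rewrite (eq_mod_zmod_char R q ((L * q + r) ^ k) (r ^ k))//.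
    by apply: eq_mod_expn; rewrite modnMDl.
  by rewrite -sumrB; apply: eq_bigr => r _; rewrite mulrBr.
apply: le_trans (normc_sum _ _ _ _ _) _.
have -> : 8 * q%:R ^+ 2 * x = \sum_(r < q) (8 * q%:R * x) :> R.
  by rewrite sumr_const card_ord -mulr_natl; ring.
apply: ler_sum => r _; rewrite normcM normc_e2pi mul1r.
apply: le_trans (normcB_e2pi _ _ _) _.
have -> : (L * q + r)%N%:R * x - L%:R * (q%:R * x) = r%:R * x.
  by rewrite natrD natrM; ring.
rewrite ger0_norm ?mulr_ge0 ?ler0n// -mulrA ler_wpM2l ?ler0n//.
by rewrite ler_wpM2r// ler_nat ltnW.
Qed.

Lemma normc_sum_zmod_char_le (q m n : nat) (u : nat -> nat) (v : nat -> R) :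
  (m <= n)%N ->
  normc (\sum_(m <= i < n) zmod_char R q (u i) * e2pi (v i)) <= (n - m)%:R.
Proof.
move=> mn; apply: le_trans (normc_sum _ _ _ _ _) _.
under eq_bigr do rewrite normcM !normc_e2pi mulr1.
by rewrite sumr_const_nat.
Qed.

(** Here [v = N^(1/4)] and [s = sqrt q <= v]. The main term is at least [s L / 4], of order
    [N / s >= v ^ 3]. Multiplied by [s], the main term less [L / 128] is at least [31/256 v ^ 4],
    while [2 q] costs at most [8/256 v ^ 4]; what remains exceeds [v ^ 4 / 16 >= s v ^ 3 / 16]. *)
Lemma major_arc_arith (N q L v s S W T : R) : 1 <= s -> q = s ^+ 2 -> 0 <= v ->
  v ^+ 4 = N -> 64 * q ^+ 2 <= N -> N <= 2 * L * q -> q <= 2 * S ^+ 2 ->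
  0 <= S -> L / 2 <= W -> S * W - L / 128 - 2 * q <= T -> v ^+ 3 / 16 <= T.
Proof.
move=> s1 -> v0 vN qN NL S2 S0 LW TT.
have sv : s <= v.
  rewrite -(@ler_pXn2r _ 4) ?nnegrE//; last lra.
  rewrite vN; have -> : s ^+ 4 = (s ^+ 2) ^+ 2 by rewrite -exprM.
  have := sqr_ge0 (s ^+ 2); lra.
have sS : s / 2 <= S.
  rewrite -(@ler_pXn2r _ 2) ?nnegrE//; last lra.
  by rewrite expr_div_n; have := sqr_ge0 s; lra.
have L0 : 0 <= L.
  have : 0 <= v ^+ 4 by rewrite exprn_ge0.
  rewrite vN => N0; have : 0 < s ^+ 2 by rewrite exprn_gt0//; lra.
  nra.
have SW : (s / 2) * (L / 2) <= S * W by apply: ler_pM => //; lra.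
apply: le_trans TT.
have H1 : s * L * 31 / 128 <= S * W - L / 128 by nra.
have H2 : v ^+ 4 <= 2 * s * (s * L) by rewrite vN; nra.
have s0 : 0 < s by lra.
have H3 : 64 * s ^+ 4 <= v ^+ 4.
  by rewrite vN; have -> : s ^+ 4 = (s ^+ 2) ^+ 2 by rewrite -exprM.
have H4 : s ^+ 3 <= s ^+ 4 by rewrite [leRHS]exprS ler_peMl ?exprn_ge0//; lra.
have H5 : s * v ^+ 3 <= v ^+ 4 by rewrite [leRHS]exprS ler_wpM2r ?exprn_ge0.
have H6 := ler_wpM2l (ltW s0) H1.
rewrite -(ler_pM2l s0).
have -> : s * (S * W - L / 128 - 2 * s ^+ 2) =
  s * (S * W - L / 128) - 2 * s ^+ 3 by ring.
move: H2 H6; set t := s * (S * W - _).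
have -> : s * (s * L * 31 / 128) = s * (s * L) * (31 / 128) by ring.
have -> : 2 * s * (s * L) = 2 * (s * (s * L)) by ring.
rewrite [s * (v ^+ 3 / 16)]mulrA.
have v4 : 0 <= v ^+ 4 by rewrite exprn_ge0.
move: (s * (s * L)) t (v ^+ 4) (s * v ^+ 3) (s ^+ 3) (s ^+ 4) H3 H4 H5 v4 => *.
lra.
Qed.

Lemma weyl_sum_major_arc (k q a b N : nat) (x v : R) : (0 < q)%N ->
  (64 * q ^ 2 <= N)%N -> 0 <= x -> 16 * N%:R * x <= 1 ->
  q%:R <= 2 * normc (complete_sum R k q a b) ^+ 2 ->
  0 <= v -> v ^+ 4 = N%:R ->
  v ^+ 3 / 16 <= normc (weyl_sum k N (b%:R / q%:R + x) (a%:R / q%:R)).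
Proof.
move=> q0 qN x0 xN Sq v0 vN.
pose T n := zmod_char R q (a * n ^ k + b * n) * e2pi (n%:R * x).
have q0' : 0 < q%:R :> R by rewrite ltr0n.
have TE : weyl_sum k N (b%:R / q%:R + x) (a%:R / q%:R) =
    \sum_(1 <= n < N.+1) T n.
  apply: eq_bigr => n _; rewrite /T /zmod_char -e2piD; congr e2pi.
  by rewrite natrD !natrM natrX; field; rewrite gt_eqF.
pose L := (N %/ q)%N.
have LN : (L * q <= N)%N by exact: leq_divM.
(* The blocks start at [n = 0], so the term [T 0] is added and subtracted. *)
have split_sum : \sum_(1 <= n < N.+1) T n =
    \sum_(0 <= n < L * q) T n + (\sum_(L * q <= n < N.+1) T n - T 0%N).
  rewrite addrA -big_cat_nat//=; last exact: leqW.
  by rewrite [in RHS]big_ltn//= addrAC subrr add0r.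
pose S := complete_sum R k q a b.
pose W := \sum_(l < L) e2pi (l%:R * (q%:R * x)).
have approx := blocks_approx k q a b L x q0 x0.
rewrite -/W -/S in approx.
have qN' : 64 * q%:R ^+ 2 <= N%:R :> R by rewrite -natrX -natrM ler_nat.
have LqN : L%:R * q%:R <= N%:R :> R by rewrite -natrM ler_nat.
have NLq : N%:R <= 2 * L%:R * q%:R :> R.
  rewrite -!natrM ler_nat.
  have := ltn_ceil N q0; rewrite -/L; have L1 : (0 < L)%N.
    by rewrite divn_gt0//; nia.
  nia.
(* The tail has at most [q] terms of modulus [1], and [T 0] adds [1 <= q]. *)
have err : normc (\sum_(L * q <= n < N.+1) T n - T 0%N) <= 2 * q%:R.
  apply: le_trans (le_normcDl _ _ _) _; rewrite normcN {2}/T normcM !normc_e2pi.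
  have := normc_sum_zmod_char_le q (L * q) N.+1 (fun n => (a * n ^ k + b * n)%N)
    (fun n => n%:R * x) (leqW LN).
  have : (N.+1 - L * q <= q)%N by have := ltn_ceil N q0; rewrite -/L; lia.
  rewrite -(ler_nat R) => H1 /le_trans/(_ H1) H2; rewrite mulr1.
  have : 1 <= q%:R :> R by rewrite ler1n.
  rewrite /T; lra.
have WL : L%:R / 2 <= normc W.
  have := sum_e2pi_ge 0 L (fun l => l%:R * (q%:R * x)) (leq0n L).
  rewrite subn0 big_mkord; apply=> l /andP[_ lL].
  rewrite !mulr_ge0 ?ler0n//= mulrA.
  have : l%:R * q%:R * x <= N%:R * x.
    by rewrite ler_wpM2r// (le_trans _ LqN)// ler_wpM2r ?ler0n// ler_nat ltnW.
  lra.
apply: (@major_arc_arith N%:R q%:R L%:R v (Num.sqrt q%:R) (normc S) (normc W)) => //.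
- by rewrite -{1}[1]sqrtr1; apply: ler_wsqrtr; rewrite ler1n.
- by rewrite sqr_sqrtr// ltW.
- by case: (S) => ? ?; exact: sqrtr_ge0.
rewrite TE split_sum -normcM.
set A := \sum_(0 <= _ < _) _ in approx *; set B := \sum_(_ <= _ < _) _ - _ in err *.
have -> : A + B = S * W + ((A - S * W) + B) by ring.
have := le_normcB _ (S * W) (A - S * W + B).
have := le_normcDl _ (A - S * W) B.
(* From [q ^ 2 <= N / 64] and [x <= 1 / (16 N)]. *)
have H : L%:R * (8 * q%:R ^+ 2 * x) <= L%:R / 128 :> R.
  by rewrite ler_wpM2l ?ler0n//; nra.
move: approx; rewrite -/A; lra.
Qed.
End MajorArc.

(** * Arcs around reduced fractions *)

Lemma coprime_cross_eq (b q b' q' : nat) : (0 < q)%N ->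
  coprime b q -> coprime b' q' -> (b * q' = b' * q)%N -> b = b' /\ q = q'.
Proof.
move=> q0 bq bq' e.
have qq' : q = q'.
  apply/eqP; rewrite eqn_dvd; apply/andP; split.
    by rewrite -(@Gauss_dvdr _ b) 1?coprime_sym// e dvdn_mull.
  by rewrite -(@Gauss_dvdr _ b') 1?coprime_sym// -e dvdn_mull.
by split=> //; move: e; rewrite -qq' => /eqP; rewrite eqn_pmul2r// => /eqP.
Qed.

Section FareyArcs.
Variable R : realType.
Local Open Scope classical_set_scope.

(** The arc extends only to the right of the fraction: the offset is then nonnegative, as
    [weyl_sum_major_arc] asks, and the arc at [0] stays in [[0, 1)]. *)
Definition farey_arc (h : R) (u : nat * nat) : set R :=
  [set` `[u.1%:R / u.2%:R, u.1%:R / u.2%:R + h[%R].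

Definition farey_pairs (s : seq nat) : seq (nat * nat) :=
  [seq (b, q) | q <- s, b <- [seq b <- index_iota 0 q | coprime q b]].

Lemma mem_farey_pairs s (u : nat * nat) :
  (u \in farey_pairs s) = [&& u.2 \in s, (u.1 < u.2)%N & coprime u.1 u.2].
Proof.
apply/allpairsPdep/and3P => [[q [b [qs + ->]]]|[us u12 cu]] /=.
  by rewrite mem_filter mem_index_iota coprime_sym => /andP[? ?]; split.
exists u.2, u.1; rewrite mem_filter mem_index_iota u12 coprime_sym cu us.
by split=> //; case: u {us u12 cu}.
Qed.

Lemma farey_pairs_uniq s : uniq s -> uniq (farey_pairs s).
Proof.
move=> us; apply: allpairs_uniq_dep => //.
  by move=> q _; rewrite filter_uniq ?iota_uniq.
by move=> [q b] [q' b'] _ _ /= [-> ->].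
Qed.

Lemma size_farey_pairs s : size (farey_pairs s) = (\sum_(q <- s) totient q)%N.
Proof.
rewrite size_allpairs_dep sumnE big_map; apply: eq_bigr => q _.
by rewrite totient_count_coprime size_filter -sum1_count big_mkcond.
Qed.

(** Distinct fractions differ by at least [1 / (q q') >= h], so a point cannot lie before the end of
    the left arc and past the start of the right one. *)
Lemma farey_arc_separated (h x : R) (b q b' q' : nat) : (0 < q)%N ->
  (0 < q')%N -> h * (q * q')%:R <= 1 -> (b * q' < b' * q)%N ->
  x < b%:R / q%:R + h -> b'%:R / q'%:R <= x -> False.
Proof.
rewrite -(ltr0n R) -(ltr0n R q') -(ler_nat R) -addn1 natrD !natrM.
move: (q%:R : R) (q'%:R : R) (b%:R : R) (b'%:R : R) => r r' c c' r0 r0' hrr lt x1 x2.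
have : c' / r' < c / r + h by exact: le_lt_trans x2 x1.
rewrite -subr_gt0 -(pmulr_lgt0 _ (mulr_gt0 r0 r0')).
have -> : (c / r + h - c' / r') * (r * r') = c * r' - c' * r + h * (r * r').
  by field; rewrite !gt_eqF.
lra.
Qed.

Lemma farey_arc_disjoint (h : R) (u w : nat * nat) :
  (0 < u.2)%N -> (0 < w.2)%N -> coprime u.1 u.2 -> coprime w.1 w.2 -> u != w ->
  h * (u.2 * w.2)%:R <= 1 -> farey_arc h u `&` farey_arc h w = set0.
Proof.
case: u w => [b q] [b' q'] /= q0 q0' bq bq' uw hqq.
have ne : (b * q' != b' * q)%N.
  apply: contraNneq uw => e; have [-> ->] := coprime_cross_eq _ _ _ _ q0 bq bq' e.
  exact: eqxx.
rewrite -subset0 => x; rewrite /farey_arc /= !in_itv /= => -[/andP[x1 x2] /andP[x3 x4]].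
move: ne; rewrite neq_ltn => /orP[lt|lt].
  exact: (farey_arc_separated h x b q b' q').
by apply: (farey_arc_separated h x b' q' b q) => //; rewrite mulnC.
Qed.

Definition farey_set (h : R) (s : seq nat) : set R :=
  \bigcup_(u in [set` farey_pairs s]) farey_arc h u.

Lemma measurable_farey_arc h u : measurable (farey_arc h u).
Proof. exact: measurable_itv. Qed.

Lemma measure_farey_arc (h : R) u : 0 <= h ->
  @lebesgue_measure R (farey_arc h u) = h%:E.
Proof.
move=> h0; rewrite /farey_arc lebesgue_measure_itv /= lte_fin.
have [->|hn0] := eqVneq h 0; first by rewrite addr0 ltxx.
by rewrite ltrDl lt0r hn0 h0 -EFinB addrAC subrr add0r.
Qed.

Lemma measurable_farey_set h s : measurable (farey_set h s).
Proof.
apply: fin_bigcup_measurable; first exact: finite_seq.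
by move=> u _; exact: measurable_farey_arc.
Qed.

Lemma farey_set_sub (h : R) s : 0 <= h ->
  (forall q, q \in s -> h * q%:R <= 1) -> farey_set h s `<=` `[0, 1[.
Proof.
move=> h0 hs x [[b q]] /=; rewrite mem_farey_pairs /= => /and3P[qs bq _].
rewrite /farey_arc /= !in_itv /= => /andP[x1 x2].
have q0 : 0 < q%:R :> R by rewrite ltr0n; lia.
rewrite (le_trans _ x1) ?divr_ge0 ?ler0n//=; apply: lt_le_trans x2 _.
(* The last fraction is [(q - 1) / q], and [h <= 1 / q]. *)
rewrite -(ler_pM2r q0) mul1r mulrDl divfK ?gt_eqF//.
have := hs q qs; have : b%:R + 1 <= q%:R :> R by rewrite natr1 ler_nat.
lra.
Qed.

Lemma measure_farey_set (h : R) s : 0 <= h -> uniq s ->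
  (forall q r, q \in s -> r \in s -> h * (q * r)%:R <= 1) ->
  (@lebesgue_measure R (farey_set h s) =
   ((\sum_(q <- s) totient q)%N%:R * h)%:E)%E.
Proof.
move=> h0 us hs; rewrite measure_fin_bigcup; first last.
- by move=> u _; exact: measurable_farey_arc.
- apply/trivIsetP => u w /=; rewrite !mem_farey_pairs.
  move=> /and3P[us' u12 cu] /and3P[ws w12 cw] uw.
  by apply: farey_arc_disjoint => //; [lia|lia|exact: hs].
- exact: finite_seq.
rewrite -fsbig_seq ?farey_pairs_uniq//.
rewrite (eq_bigr (fun=> h%:E)); last by move=> u _; exact: measure_farey_arc.
rewrite -size_farey_pairs sumEFin; congr EFin.
by rewrite big_const_seq count_predT iter_addr_0 mulr_natl.
Qed.

End FareyArcs.

(** * Norm of the maximal function *)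

Lemma nat_sqrt_bounds (A N : nat) : (0 < A)%N ->
  exists J, (A * J ^ 2 <= N < A * J.+1 ^ 2)%N.
Proof.
move=> A0; elim: N => [|N [J /andP[JN NJ]]]; first by exists 0%N; rewrite muln0 muln_gt0 A0.
have [NJ1|] := ltnP N.+1 (A * J.+1 ^ 2).
  by exists J; rewrite NJ1 andbT (leq_trans JN).
move=> JN1; exists J.+1; rewrite JN1 /= (leq_ltn_trans NJ)//.
by rewrite ltn_pmul2l// ltn_sqr.
Qed.

Section Maximal.
Variable R : realType.

Lemma weyl_maximal_ge (k N : nat) (x t m : R) : 0 < t < 1 ->
  m <= normc (weyl_sum k N x t) -> (m%:E <= weyl_maximal k N x)%E.
Proof.
move=> t01 mt; apply: (@le_trans _ _ (normc (weyl_sum k N x t))%:E).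
  by rewrite lee_fin.
by apply: ereal_sup_ubound; exists t => //=; rewrite in_itv.
Qed.

(** For [0 <= x < 1 / (32 N)] and [t = 1 / (32 N^k)], both parts of each phase are at most [1/32],
    so [sum_e2pi_ge] gives modulus at least [N / 2]. *)
Lemma Lnorm_weyl_maximal_ge_trivial (k N : nat) (p : R) : 0 < p -> (0 < N)%N ->
  ((N%:R / 2 * (32^-1 * N%:R^-1) `^ p^-1)%:E <=
    'N[torus_measure R]_p%:E[weyl_maximal k N])%E.
Proof.
move=> p0 N0; have N1 : 1 <= N%:R :> R by rewrite ler1n.
have NV : 0 < N%:R^-1 :> R by rewrite invr_gt0; lra.
have NV1 : N%:R^-1 <= 1 :> R by rewrite invf_le1//; lra.
apply: (@Lnorm_torus_ge _ _ _ _ _ [set` `[0, 32^-1 * N%:R^-1[]) => //.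
- by move=> x /=; rewrite !in_itv /= => /andP[-> /=]; lra.
- rewrite lebesgue_measure_itv /= lte_fin ifT ?sube0//; lra.
move=> x /=; rewrite in_itv /= => /andP[x0 x1].
pose t : R := 32^-1 * N%:R ^- k.
have Nk : 0 < N%:R ^- k :> R by rewrite invr_gt0 exprn_gt0//; lra.
have Nk1 : N%:R ^- k <= 1 :> R by rewrite invf_le1 ?exprn_gt0 ?exprn_ege1//; lra.
apply: (@weyl_maximal_ge _ _ _ t); first by rewrite /t; apply/andP; split; lra.
have := @sum_e2pi_ge R 1 N.+1 (fun n => n%:R * x + n%:R ^+ k * t) (ltn0Sn N).
rewrite subSS subn0; apply=> // n /andP[n1]; rewrite ltnS -(ler_nat R) => nN.
have n0 : 0 <= n%:R :> R by rewrite ler0n.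
have t0 : 0 <= t by rewrite /t; lra.
rewrite addr_ge0 ?mulr_ge0 ?exprn_ge0//=.
have H1 : n%:R * x <= 32^-1.
  apply: (@le_trans _ _ (N%:R * (32^-1 * N%:R^-1))).
    by apply: ler_pM => //; exact: ltW.
  by rewrite mulrCA mulfV ?mulr1// gt_eqF//; lra.
have H2 : n%:R ^+ k * t <= 32^-1.
  apply: (@le_trans _ _ (N%:R ^+ k * t)).
    by rewrite ler_wpM2r// lerXn2r// nnegrE; lra.
  by rewrite /t mulrCA mulfV ?mulr1// gt_eqF// exprn_gt0//; lra.
lra.
Qed.

Lemma Lnorm_weyl_maximal_ge_major (k : nat) (p : R) : (0 < k)%N -> 0 < p ->
  exists (c : R) (N0 : nat), 0 < c /\ forall N : nat, (N0 <= N)%N ->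
    ((c * N%:R `^ (3 / 4))%:E <=
      'N[torus_measure R]_p%:E[weyl_maximal k N])%E.
Proof.
move=> k0 p0; have [M [J0 [M0 HM]]] := good_moduli R k k0.
(* With [q, r <= 2 M J] and [A J ^ 2 <= N] this yields [64 q r <= N], which serves both the major
   arc estimate and the disjointness of the arcs. *)
pose A := (256 * M ^ 2)%N.
have A0 : (0 < A)%N by rewrite /A muln_gt0 expn_gt0 M0.
have M0' : 0 < M%:R :> R by rewrite ltr0n.
exists (16^-1 * (256 ^+ 2 * M%:R)^-1 `^ p^-1), (A * (J0.+1) ^ 2)%N.
have c0 : 0 < (256 ^+ 2 * M%:R)^-1 :> R by rewrite invr_gt0 mulr_gt0 ?exprn_gt0 ?ltr0n.
split; first by rewrite mulr_gt0 ?invr_gt0 ?powR_gt0.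
move=> N NN.
(* [J] is the integer part of [sqrt (N / A)]; the lower bound on [N] forces [J > J0]. *)
have [J /andP[JN NJ]] := nat_sqrt_bounds A N A0.
have JJ0 : (J0 < J)%N.
  by have := leq_ltn_trans NN NJ; rewrite ltn_pmul2l// ltn_sqr.
have [s [us sJ sq]] := HM J (ltnW JJ0).
have N0 : (0 < N)%N by apply: leq_trans NN; rewrite muln_gt0 A0 expn_gt0.
have N0' : 0 < N%:R :> R by rewrite ltr0n.
pose h : R := 16^-1 * N%:R^-1.
have h0 : 0 < h by rewrite mulr_gt0 ?invr_gt0.
have hN : h * N%:R = 16^-1 by rewrite /h -mulrA mulVf ?mulr1 ?gt_eqF.
have q2 q r : q \in s -> r \in s -> (64 * (q * r) <= N)%N.
  move=> /sq[_ qM _ _] /sq[_ rM _ _]; apply: leq_trans JN.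
  have := leq_mul qM rM; rewrite /A; nia.
have hqr q r : q \in s -> r \in s -> h * (q * r)%:R <= 1.
  move=> qs rs; have := q2 q r qs rs; rewrite -(ler_nat R) natrM => H.
  have : h * (64 * (q * r)%:R) <= h * N%:R by rewrite ler_wpM2l// ltW.
  by rewrite hN; nra.
have hq q : q \in s -> h * q%:R <= 1.
  move=> qs; apply: le_trans (hqr q q qs qs); rewrite ler_wpM2l ?(ltW h0)//.
  by rewrite ler_nat; case: (q) => // ?; rewrite leq_pmulr.
have mE := measure_farey_set R h s (ltW h0) us hqr.
pose v : R := N%:R `^ 4^-1.
have v0 : 0 <= v by exact: powR_ge0.
have v4 : v ^+ 4 = N%:R.
  by rewrite -powR_mulrn// -powRrM mulVf ?powRr1 ?ler0n// pnatr_eq0.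
have v3 : N%:R `^ (3 / 4) = v ^+ 3.
  by rewrite -powR_mulrn// -powRrM mulrC.
have -> : 16^-1 * (256 ^+ 2 * M%:R)^-1 `^ p^-1 * N%:R `^ (3 / 4) =
    (v ^+ 3 / 16) * (256 ^+ 2 * M%:R)^-1 `^ p^-1.
  by rewrite v3; ring.
apply: (@Lnorm_torus_ge _ _ _ _ _ (farey_set R h s)) => //.
- by rewrite divr_ge0 ?exprn_ge0.
- exact: measurable_farey_set.
- by apply: farey_set_sub => //; exact: ltW.
- rewrite mE lee_fin.
  (* There are at least [J / 2] moduli, each with totient at least [M J / 2]. Since
     [N <= 4 A J ^ 2 = 1024 M ^ 2 J ^ 2] and [h = 1 / (16 N)], the measure is at least
     [1 / (64 * 1024 M) = 1 / (256 ^ 2 M)]. *)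
  have : (J * (M * J) <= 4 * \sum_(q <- s) totient q)%N.
    have : (size s * (M * J) <= 2 * \sum_(q <- s) totient q)%N.
      rewrite -sum1_size big_distrl big_distrr /= big_seq [leqRHS]big_seq.
      by apply: leq_sum => q /sq[qM _ qt _]; rewrite mul1n (leq_trans (ltnW qM)).
    move: (\sum_(q <- s) totient q)%N => T H.
    apply: (@leq_trans (2 * size s * (M * J))); first by rewrite leq_mul2r sJ orbT.
    by rewrite -mulnA; lia.
  rewrite -(ler_nat R) !natrM; move: (\sum_(q <- s) totient q)%N => T H.
  have NJ2 : N%:R <= 1024 * M%:R ^+ 2 * J%:R ^+ 2 :> R.
    rewrite -!natrX -!natrM ler_nat; apply: leq_trans (ltnW NJ) _.
    have : (J.+1 <= 2 * J)%N by lia.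
    by move=> /(leq_mul (leqnn _)) ; rewrite /A; nia.
  rewrite -(ler_pM2r N0') -(mulrA T%:R) hN.
  have K0 : 0 < 256 ^+ 2 * M%:R :> R by rewrite -invr_gt0.
  rewrite [leLHS]mulrC ler_pdivrMr//; apply: le_trans NJ2 _.
  have -> : 1024 * M%:R ^+ 2 * J%:R ^+ 2 = 1024 * M%:R * (J%:R * (M%:R * J%:R)) :> R.
    by move: (J%:R : R) (M%:R : R) => y m; ring.
  have -> : T%:R * 16^-1 * (256 ^+ 2 * M%:R) = 1024 * M%:R * (4 * T%:R) :> R.
    by move: (T%:R : R) (M%:R : R) => y m; field.
  by apply: ler_wpM2l H; apply: mulr_ge0; [exact: ler0n|exact: ltW].
move=> x [[b q]] /=; rewrite mem_farey_pairs /= => /and3P[qs bq cbq].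
rewrite /farey_arc /= in_itv /= => /andP[x1 x2].
have [qM _ _ /(_ b cbq)[a /andP[a0 aq] aS]] := sq q qs.
have q0 : (0 < q)%N by exact: ltn_trans aq.
have q0' : 0 < q%:R :> R by rewrite ltr0n.
apply: (@weyl_maximal_ge _ _ _ (a%:R / q%:R)).
  by rewrite divr_gt0 ?ltr0n//= ltr_pdivrMr// mul1r ltr_nat.
have -> : x = b%:R / q%:R + (x - b%:R / q%:R) by rewrite addrC subrK.
apply: weyl_sum_major_arc => //.
- exact: q2.
- by rewrite subr_ge0.
- have : N%:R * (x - b%:R / q%:R) <= N%:R * h.
    by rewrite ler_wpM2l ?ler0n//; lra.
  by rewrite [_ * h]mulrC hN; lra.
Qed.

End Maximal.

Theorem theorem1p3 (R : realType) (k : nat) (p : R)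
    (hk : (3 <= k)%N) (hp : 1 <= p) :
  exists (c : R) (N0 : nat), 0 < c /\
    forall N : nat, (N0 <= N)%N ->
      ((c * N%:R `^ (2^-1 + gamma_exponent p))%:E <=
       'N[torus_measure R]_p%:E[weyl_maximal k N])%E.
Proof.
have p0 : 0 < p by exact: lt_le_trans hp.
rewrite /gamma_exponent; have [p4|p4] := leP p 4.
  have -> : 2^-1 + 4^-1 = 3 / 4 :> R by lra.
  by apply: Lnorm_weyl_maximal_ge_major => //; exact: leq_trans hk.
exists (2^-1 * 32^-1 `^ p^-1), 1%N.
split; first by rewrite mulr_gt0 ?invr_gt0 ?powR_gt0.
move=> N N0; apply: le_trans (Lnorm_weyl_maximal_ge_trivial R k N p p0 N0).
have N0' : 0 < N%:R :> R by rewrite ltr0n.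
(* The two sides are equal, because [N * N^(-1/p) = N^(1/2 + (1/2 - 1/p))]. *)
rewrite lee_fin le_eqVlt; apply/orP; left; apply/eqP.
rewrite powRM ?invr_ge0 ?ler0n// -(powR_inv1 (ler0n R N)) -powRrM mulN1r.
have -> : 2^-1 + (2^-1 - p^-1) = 1 - p^-1 by lra.
rewrite powRD; last by rewrite [X in _ ==> ~~ X]gt_eqF ?implybT.
rewrite powRr1 ?ler0n//.
move: (32^-1 `^ p^-1) (N%:R `^ (- p^-1)) => x y; ring.
Qed.
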